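(* Let $X$ be a compact metric space and $f\colon X\to X$ a continuous map with the shadowing property. If $\dim X=0$, then $\mathcal{C}(f)=\overline{\mathcal{C}_{sh}(f)}$, i.e., $\mathcal{C}_{sh}(f)$ is dense in $\mathcal{C}(f)$.
   Context: A $\delta$-chain of $f$ is a finite sequence $(x_i)_{i=0}^k$, $k>0$, with $d(f(x_i),x_{i+1})\le\delta$ for all $0\le i<k$; write $x\to_{f,\delta}y$ if there is one with $x_0=x$, $x_k=y$. $CR(f)$ is the set of $x$ with $x\to_{f,\delta}x$ for all $\delta>0$. For $x,y\in CR(f)$, $x\leftrightarrow_f y$ iff $x\to_{f,\delta}y$ and $y\to_{f,\delta}x$ for all $\delta>0$; this is a closed equivalence relation on $CR(f)$ whose classes are the chain components, and $\mathcal{C}(f)=CR(f)/\leftrightarrow_f$ is the set of chain components endowed with the quotient topology (a compact metrizable space). Each chain component $C$ is closed and $f$-invariant. $f$ has the shadowing property if for every $\epsilon>0$ there is $\delta>0$ such that for every sequence $(x_i)_{i\ge0}$ with $d(f(x_i),x_{i+1})\le\delta$ for all $i$ there is $x$ with $d(f^i(x),x_i)\le\epsilon$ for all $i$. $\mathcal{C}_{sh}(f)=\{C\in\mathcal{C}(f): f|_C\colon C\to C$ has the shadowing property$\}$. *)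

(* Defs.v *)
From HB Require Import structures.
From mathcomp Require Import all_boot all_order all_algebra.
From mathcomp Require Import all_classical all_reals all_analysis.
Set Implicit Arguments. Unset Strict Implicit. Unset Printing Implicit Defensive.
Import Order.TTheory GRing.Theory Num.Theory.
Local Open Scope classical_set_scope.
Local Open Scope ring_scope.

Section ChainDefs.
Context {R : realType} {X : metricType R}.

Definition chain_to (f : X -> X) (delta : R) (x y : X) : Prop :=
  exists (k : nat) (s : nat -> X),
    [/\ (0 < k)%N, s 0%N = x, s k = y &
        forall i, (i < k)%N -> mdist (f (s i)) (s i.+1) <= delta].

Definition chain_recurrent (f : X -> X) : set X :=
  [set x | forall delta, 0 < delta -> chain_to f delta x x].

Definition chain_equiv (f : X -> X) (x y : X) : Prop :=
  [/\ chain_recurrent f x, chain_recurrent f y &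
      forall delta, 0 < delta -> chain_to f delta x y /\ chain_to f delta y x].

Definition chain_component (f : X -> X) (x : X) : set X :=
  [set y | chain_equiv f x y].

(* f restricted to the invariant set C (as a map C -> C with the induced
   metric) has the shadowing property *)
Definition shadowing_on (f : X -> X) (C : set X) : Prop :=
  forall eps, 0 < eps -> exists2 delta, 0 < delta &
    forall s : nat -> X, (forall i, C (s i)) ->
      (forall i, mdist (f (s i)) (s i.+1) <= delta) ->
      exists x, C x /\ forall i, mdist (iter i f x) (s i) <= eps.

Definition shadowing (f : X -> X) : Prop := shadowing_on f setT.

Definition covering_dim_zero : Prop :=
  forall (n : nat) (U : 'I_n -> set X),
    (forall i, open (U i)) -> \bigcup_i U i = setT ->
    exists (m : nat) (V : 'I_m -> set X),
      [/\ forall j, open (V j), \bigcup_j V j = setT,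
          forall j, exists i, V j `<=` U i &
          forall j k, j != k -> V j `&` V k = set0].

End ChainDefs.

(* Main.v *)
(* Let E_0, E_1, ... be finer and finer partitions of X into clopen cells, and let d_n be
   such that every d_n-pseudo-orbit has the E_n-itinerary of a true orbit. Say that x is
   n-traced by y if the E_n-itinerary of every d_n-pseudo-orbit inside the d_n-chain class
   of x is realized by a true orbit inside the chain component of y. If x is n-traced by
   itself for every n, then f has the shadowing property on the chain component of x.

   Every chain recurrent x is n-traced by some y: periodic d_n-pseudo-orbits through longer
   and longer lists of words are shadowed by recurrent orbits, and y is a limit of these.
   To have y = x, order points by inclusion of the sets of E_n-itineraries of their d_n-chain
   classes. There are finitely many classes, so the current closed set T_n of candidates
   has a maximal point b_n; let T_(n+1) be the points of T_n by which b_n is n-traced. By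
   maximality each of them is n-traced by itself, and by compactness the T_n have a common
   point. Starting from the points whose chain component meets a cell around a point of V
   keeps that point in V. *)

Require Import Defs.
From HB Require Import structures.
From mathcomp Require Import all_boot all_order all_algebra.
From mathcomp Require Import all_classical all_reals all_analysis.
From mathcomp Require Import lra zify.
Import Order.TTheory GRing.Theory Num.Theory.
Local Open Scope classical_set_scope.
Local Open Scope ring_scope.

(** * Compactness and finite clopen partitions *)

Section MetricFacts.
Context {R : realType} {X : metricType R}.
Implicit Types (x y : X) (e : R).

Lemma nbhs_mdist x (A : set X) :
  nbhs x A <-> exists2 e, 0 < e & forall y, mdist x y < e -> A y.
Proof.
split.
  move=> /nbhs_ballP[e e0 xeA]; exists e => // y xy.
  by apply: xeA; rewrite ballEmdist.
move=> [e e0 xeA]; apply/nbhs_ballP; exists e => // y.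
by rewrite ballEmdist; exact: xeA.
Qed.

Lemma continuous_mdist (g : X -> X) x e : continuous g -> 0 < e ->
  exists2 d, 0 < d & forall y, mdist x y < d -> mdist (g x) (g y) < e.
Proof.
move=> cg e0; apply/nbhs_mdist; apply: (cg x [set z | mdist (g x) z < e]).
by apply/nbhs_mdist; exists e.
Qed.

Lemma continuous_iter (g : X -> X) n : continuous g -> continuous (iter n g).
Proof.
move=> cg; elim: n => [|n IHn] x; first exact: cvg_id.
by apply: (@continuous_comp _ _ _ (iter n g) g); [exact: IHn|exact: cg].
Qed.

Lemma compact_seq_cluster (u : nat -> X) : compact [set: X] ->
  exists x, forall e N, 0 < e -> exists2 n, (N <= n)%N & mdist x (u n) < e.
Proof.
move=> cX; have [x [_ xu]] := cX (u @ \oo) _ filterT.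
exists x => e N e0.
have uN : (u @ \oo) [set y | exists2 n, (N <= n)%N & y = u n].
  by exists N => // n /= Nn; exists n.
have xe : nbhs x [set y | mdist x y < e] by apply/nbhs_mdist; exists e.
by have [_ [[n Nn ->] ?]] := xu _ _ uN xe; exists n.
Qed.

Lemma compact_seq_cluster_mem (F : nat -> set X) : compact [set: X] ->
  (forall n, closed (F n)) -> (forall n m, (n <= m)%N -> F m `<=` F n) ->
  (forall n, F n !=set0) -> exists x, forall n, F n x.
Proof.
move=> cX cF dF F0; have [u Fu] := choice F0.
have [x xu] := compact_seq_cluster u cX.
exists x => n; apply: cF => A /nbhs_mdist[e e0 xeA].
have [m nm xm] := xu e n e0.
by exists (u m); split; [exact: dF nm _ (Fu m)|exact: xeA].
Qed.

Lemma compact_totally_bounded e : compact [set: X] -> 0 < e ->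
  exists D : seq X, forall x, exists2 z, z \in D & mdist z x < e.
Proof.
move=> cX e0; apply: contrapT => nD.
pose B (D : seq X) := [set x | forall z, z \in D -> e <= mdist z x].
have PF : ProperFilter (filter_from [set: seq X] B).
  apply: filter_from_proper => [|D _].
    apply: filter_from_filter; first by exists [::].
    move=> D1 D2 _ _; exists (D1 ++ D2) => // x xD.
    by split=> z zD; apply: xD; rewrite mem_cat zD ?orbT.
  apply: contrapT => D0; apply: nD; exists D => x.
  apply: contrapT => xD; apply: D0; exists x => z zD.
  by rewrite leNgt; apply/negP => zx; apply: xD; exists z.
have [x [_ xB]] := cX _ PF filterT.
have xe : nbhs x [set y | mdist x y < e] by apply/nbhs_mdist; exists e.
have [|y [yB /= yx]] := xB (B [:: x]) _ _ xe; first by exists [:: x].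
by have := yB x (mem_head _ _); rewrite leNgt yx.
Qed.

(** Zero-dimensionality enters only here: a finite cover by balls of radius [e / 2] is refined to
    disjoint open sets, and [q] names the one containing a point. *)
Lemma finite_cells e : compact [set: X] -> @covering_dim_zero R X -> 0 < e ->
  exists (N : nat) (q : X -> 'I_N),
    (forall x y, q x = q y -> mdist x y < e) /\
    (forall x, nbhs x [set y | q x = q y]).
Proof.
move=> cX X0 e0.
have oB x : open [set y : X | mdist x y < e / 2].
  rewrite openE => y /= xy; apply/nbhs_mdist; exists (e / 2 - mdist x y).
    by rewrite subr_gt0.
  move=> z; rewrite ltrBrDl; exact/le_lt_trans/metric_triangle.
have [D XD] := compact_totally_bounded _ cX (divr_gt0 e0 (ltr0Sn R 1) : 0 < e / 2).
have [m [V [oV VT VU V0]]] : exists (m : nat) (V : 'I_m -> set X),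
    [/\ forall j, open (V j), \bigcup_j V j = setT,
        forall j, exists x, V j `<=` [set y | mdist x y < e / 2] &
        forall j k, j != k -> V j `&` V k = set0].
  have [] := X0 (size D) (fun i => [set y | mdist (tnth (in_tuple D) i) y < e / 2]).
  - by move=> i; exact: oB.
  - apply/seteqP; split => // x _; have [z zD zx] := XD x.
    have zD' : (index z D < size D)%N by rewrite index_mem.
    exists (Ordinal zD') => //=.
    by rewrite (tnth_nth z) /= nth_index.
  - move=> m [V [oV VT VU V0]]; exists m, V; split => // j.
    by have [i Vi] := VU j; exists (tnth (in_tuple D) i).
have Vx x : exists j, V j x.
  have [j _ Vj] : (\bigcup_j V j) x by rewrite VT.
  by exists j.
have [q qV] := choice Vx.
exists m, q; split => [x y qxy|x].
- have [z zV] := VU (q x).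
  have zx := zV _ (qV x); have := zV y; rewrite qxy => /(_ (qV y)) zy.
  rewrite (le_lt_trans (metric_triangle _ z _))// metric_sym.
  by rewrite (splitr e) ltrD.
- have : nbhs x (V (q x)) by apply: open_nbhs_nbhs; split.
  apply: filterS => y Vy /=; apply/eqP/negPn/negP => qxy.
  suff : (V (q x) `&` V (q y)) y by rewrite (V0 _ _ qxy).
  by split => //; exact: qV.
Qed.

(** A Lebesgue number argument: ever closer pairs with different values would accumulate at a point
    near which [q] is constant. *)
Lemma locally_constant_uniform (T : Type) (q : X -> T) : compact [set: X] ->
  (forall x, nbhs x [set y | q x = q y]) ->
  exists2 e, 0 < e & forall x y, mdist x y < e -> q x = q y.
Proof.
move=> cX lq; apply: contrapT => nq.
have /choice[u uP] n : exists xy : X * X,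
    mdist xy.1 xy.2 < n.+1%:R^-1 /\ q xy.1 <> q xy.2.
  apply: contrapT => nn; apply: nq; exists n.+1%:R^-1; first by rewrite invr_gt0.
  move=> x y xy; apply: contrapT => qxy; apply: nn.
  by exists (x, y).
have [x xu] := compact_seq_cluster (fun n => (u n).1) cX.
have /nbhs_mdist[e e0 xe] := lq x.
have [N _ HN] := near_infty_natSinv_lt (PosNum (divr_gt0 e0 (ltr0Sn R 1) : 0 < e / 2)).
have e20 : 0 < e / 2 by rewrite divr_gt0.
have [n Nn xn] := xu (e / 2) N e20.
have [un qun] := uP n; apply: qun.
rewrite -(xe (u n).1) -?(xe (u n).2)//.
  rewrite (le_lt_trans (metric_triangle _ (u n).1 _))//.
  by rewrite (splitr e) ltrD// (lt_trans un)//; exact: (HN n).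
by rewrite (lt_trans xn)// gtr_pMr// invf_lt1// ltr1n.
Qed.

End MetricFacts.

(** * Chains, chain recurrence and chain classes *)

Section Chains.
Context {R : realType} {X : metricType R} (f : X -> X).
Implicit Types (x y z t : X) (d e : R).

Definition step d : rel X := fun x y => mdist (f x) y <= d.

Definition pseudo_orbit d (s : nat -> X) := forall i, step d (s i) (s i.+1).

Lemma chain_toP d x y :
  chain_to f d x y <-> exists p, [/\ p != [::], path (step d) x p & last x p = y].
Proof.
split=> [[k [s [k0 <- <- sd]]]|[p [p0 dp <-]]].
  exists (mkseq (fun i => s i.+1) k); split.
  - by rewrite -size_eq0 size_mkseq -lt0n.
  - apply/(pathP (s 0%N)) => i; rewrite size_mkseq => ik.
    by case: i ik => [|i] ik /=; rewrite /step ?nth_mkseq ?sd// ltnW.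
  - case: k k0 sd => // k _ _.
    by rewrite (last_nth (s 0%N)) size_mkseq /= nth_mkseq.
exists (size p), (nth x (x :: p)); split => //.
- by rewrite lt0n size_eq0.
- by rewrite (last_nth x).
- by move=> i ip; exact: (pathP x dp).
Qed.

Lemma chain_to_trans d x y z :
  chain_to f d x y -> chain_to f d y z -> chain_to f d x z.
Proof.
move=> /chain_toP[p [p0 dp py]] /chain_toP[r [r0 dr rz]]; apply/chain_toP.
exists (p ++ r); split; first by case: p p0 {dp py}.
  by rewrite cat_path dp py.
by rewrite last_cat py.
Qed.

Lemma chain_to_step d x : 0 <= d -> chain_to f d x (f x).
Proof.
by move=> d0; apply/chain_toP; exists [:: f x]; rewrite /= /step mdistxx d0.
Qed.

Lemma chain_to_le d d' x y : d <= d' -> chain_to f d x y -> chain_to f d' x y.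
Proof.
move=> dd' [k [s [k0 sx sy sd]]]; exists k, s; split => // i ik.
exact: le_trans (sd i ik) dd'.
Qed.

(** Only the endpoints move, and the start matters only through its image. In a chain of one jump
    both changes fall on that jump, hence three errors of [d / 3]. *)
Lemma chain_to_perturb d x x' y y' : chain_to f (d / 3) x y ->
  mdist (f x) (f x') <= d / 3 -> mdist y y' <= d / 3 -> chain_to f d x' y'.
Proof.
move=> [k [s [k0 sx sy sd]]] xx' yy'.
have d0 : 0 <= d / 3 by exact: le_trans (mdist_ge0 _ _) xx'.
exists k, (fun i => if i == 0%N then x' else if i == k then y' else s i).
split => [//|//||i ik].
  by rewrite eqxx; case: eqP k0 => // ->.
have i1 : mdist (f (if i == 0%N then x' else s i)) (f (s i)) <= d / 3.
  case: eqP => [->|_]; last by rewrite mdistxx.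
  by rewrite sx metric_sym.
have i2 : mdist (s i.+1) (if i.+1 == k then y' else s i.+1) <= d / 3.
  case: eqP => [->|_]; last by rewrite mdistxx.
  by rewrite sy.
rewrite (ltn_eqF ik) /=.
have := metric_triangle (f (if i == 0%N then x' else s i)) (f (s i))
  (if i.+1 == k then y' else s i.+1).
have := metric_triangle (f (s i)) (s i.+1) (if i.+1 == k then y' else s i.+1).
have := sd i ik.
lra.
Qed.

Lemma chain_to_perturbr d x y y' : chain_to f (d / 3) x y ->
  mdist y y' <= d / 3 -> chain_to f d x y'.
Proof.
move=> xy yy'; apply: (chain_to_perturb d _ _ _ _ xy) => //.
rewrite mdistxx; exact: le_trans (mdist_ge0 _ _) yy'.
Qed.

(* The level-[d] approximation of a chain component: unlike chain_component, it
   takes only finitely many values as x ranges over the chain recurrent set. *)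
Definition chain_class d x : set X := [set y | chain_to f d x y /\ chain_to f d y x].

Lemma chain_equiv_class d x y : 0 < d -> chain_equiv f x y -> chain_class d x y.
Proof. by move=> d0 [_ _ xy]; exact: xy. Qed.

Lemma chain_equiv_sym x y : chain_equiv f x y -> chain_equiv f y x.
Proof. by move=> [cx cy xy]; split => // d /xy[]. Qed.

Lemma chain_equiv_refl x : chain_recurrent f x -> chain_equiv f x x.
Proof. by move=> cx; split => // d d0; split; exact: cx. Qed.

Lemma chain_class_close d x x' : chain_recurrent f x -> chain_recurrent f x' ->
  mdist x x' <= d / 3 -> chain_class d x `<=` chain_class d x'.
Proof.
move=> cx cx' xx' y [xy yx].
have d3 : 0 <= d / 3 by exact: le_trans (mdist_ge0 _ _) xx'.
have : d / 3 = 0 \/ 0 < d / 3 by lra.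
case=> [d0|d0].
  have -> : x' = x by apply/esym/mdist_positivity/le_anti; rewrite mdist_ge0 -d0 xx'.
  by [].
split; [apply: chain_to_trans xy|apply: chain_to_trans yx _].
  by apply: (chain_to_perturbr _ _ _ _ (cx' _ d0)); rewrite metric_sym.
by apply: (chain_to_perturbr _ _ _ _ (cx _ d0)).
Qed.

Hypothesis cf : continuous f.

(** A fine loop at [x] jumps first to some [y] near [f x]; as [f y] is near [f (f x)], the rest of
    the loop can start from [f x]. A loop of one jump has [y = x] and is estimated directly. *)
Lemma chain_recurrent_image x : chain_recurrent f x -> chain_equiv f x (f x).
Proof.
move=> cx; suff fx d : 0 < d -> chain_to f d (f x) x.
  split => // d d0; last by split; [exact/chain_to_step/ltW|exact: fx].
  by apply: chain_to_trans (fx _ d0) _; exact/chain_to_step/ltW.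
move=> d0; have d30 : 0 < d / 3 by lra.
have [e e0 xe] := continuous_mdist f (f x) (d / 3) cf d30.
pose r := Num.min (d / 3) (e / 2).
have r0 : 0 < r by rewrite lt_min; apply/andP; split; lra.
have rd : r <= d / 3 by rewrite ge_min lexx.
have re : r <= e / 2 by rewrite ge_min lexx orbT.
have /chain_toP[[|y p] []//= _ /andP[xy yp] px] : chain_to f r x x by exact: cx.
have xy' : mdist (f (f x)) (f y) <= d / 3.
  by apply/ltW/xe; rewrite (le_lt_trans xy)//; lra.
case: p yp px => [_ yx|z p yp px]; last first.
  apply: (chain_to_perturb _ y _ x); last by rewrite mdistxx ltW.
    by apply: (chain_to_le r) => //; apply/chain_toP; exists (z :: p).
  by rewrite metric_sym.
move: yx xy xy' => /= -> xy xy'.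
apply/chain_toP; exists [:: x]; split => //=; rewrite andbT /step.
have := metric_triangle (f (f x)) (f x) x; rewrite /step in xy.
lra.
Qed.

Lemma chain_equiv_trans x y z :
  chain_equiv f x y -> chain_equiv f y z -> chain_equiv f x z.
Proof.
move=> [cx cy xy] [_ cz yz]; split => // d d0.
have [dxy dyx] := xy d d0; have [dyz dzy] := yz d d0.
by split; [exact: chain_to_trans dxy dyz|exact: chain_to_trans dzy dyx].
Qed.

Lemma chain_equiv_iter x y i : chain_equiv f x y -> chain_equiv f x (iter i f y).
Proof.
move=> xy; elim: i => //= i xi.
apply: (chain_equiv_trans _ _ _ xi).
by apply: chain_recurrent_image; case: xi.
Qed.

Lemma chain_equiv_closed x y :
  (forall e, 0 < e -> exists x' y',
     [/\ mdist x x' < e, mdist y y' < e & chain_equiv f x' y']) ->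
  chain_equiv f x y.
Proof.
move=> xy.
have lim x1 y1 d : 0 < d ->
    (forall e, 0 < e -> exists x' y',
      [/\ mdist x1 x' < e, mdist y1 y' < e & forall d', 0 < d' -> chain_to f d' x' y']) ->
    chain_to f d x1 y1.
  move=> d0 xy1; have d30 : 0 < d / 3 by lra.
  have [e e0 xe] := continuous_mdist f x1 (d / 3) cf d30.
  have [|x' [y' [xx' yy' xy']]] := xy1 (Num.min e (d / 3)).
    by rewrite lt_min e0.
  move: xx' yy'; rewrite !lt_min => /andP[xx' _] /andP[_ yy'].
  apply: (chain_to_perturb _ _ _ _ _ (xy' _ d30)); rewrite metric_sym ltW//.
  exact: xe.
split.
- move=> d d0; apply: lim => // e /xy[x' [y' [xx' _ [cx _ _]]]].
  by exists x', x'.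
- move=> d d0; apply: lim => // e /xy[x' [y' [_ yy' [_ cy _]]]].
  by exists y', y'.
- move=> d d0; split; apply: lim => // e /xy[x' [y' [xx' yy' [_ _ xy']]]].
    by exists x', y'; split => // d' /xy'[].
  by exists y', x'; split => // d' /xy'[].
Qed.

Hypothesis cX : compact [set: X].

Lemma closed_chain_saturation (F : set X) : closed F ->
  closed [set x | exists2 t, chain_equiv f x t & F t].
Proof.
move=> cF x Fx.
have /choice[u uP] n : exists xt : X * X,
    [/\ mdist x xt.1 < n.+1%:R^-1, chain_equiv f xt.1 xt.2 & F xt.2].
  have [|y [[t yt Ft] xy]] := Fx [set y | mdist x y < n.+1%:R^-1].
    by apply/nbhs_mdist; exists n.+1%:R^-1; rewrite ?invr_gt0.
  by exists (y, t).
have [t tu] := compact_seq_cluster (fun n => (u n).2) cX.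
exists t.
  apply: chain_equiv_closed => e e0.
  have [N _ HN] := near_infty_natSinv_lt (PosNum e0).
  have [n Nn tn] := tu e N e0.
  have [xn un _] := uP n; exists (u n).1, (u n).2; split => //.
  by rewrite (lt_trans xn)//; exact: (HN n).
apply: cF => A /nbhs_mdist[e e0 tA].
by have [n _ tn] := tu e 0%N e0; exists (u n).2; split; [by case: (uP n)|exact: tA].
Qed.

Lemma closed_chain_recurrent : closed (chain_recurrent f).
Proof.
move=> x cx; suff [] : chain_equiv f x x by [].
apply: chain_equiv_closed => e e0.
have [|y [cy xy]] := cx [set y | mdist x y < e]; first by apply/nbhs_mdist; exists e.
by exists y, y; split => //; exact: chain_equiv_refl.
Qed.

End Chains.

Lemma nth_cons_cat (T : Type) (x y : T) (p r : seq T) i :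
  nth x (y :: p ++ r) (size p + i) = nth x (last y p :: r) i.
Proof.
by rewrite -cat_cons lastI cat_rcons nth_cat size_belast ltnNge leq_addr /= addKn.
Qed.

(** * Tracing the pseudo-orbits of a chain class inside one chain component *)

Section Tracing.
Context {R : realType} {X : metricType R} (f : X -> X).
Context (E : X -> X -> Prop) (d : R).

Definition traces (s : nat -> X) (t : X) := forall i, E (s i) (iter i f t).

Definition class_traced x y := forall s, pseudo_orbit f d s ->
  (forall i, chain_class f d x (s i)) -> exists2 t, chain_equiv f y t & traces s t.

(* A word is an itinerary of length l; finitely many loops through x, one for each
   word occurring in the class of x, are concatenated. *)
Lemma loop_through_words (T : finType) (q : X -> T) l x
    (ws : seq {ffun 'I_l -> T}) : chain_to f d x x ->
  exists p, [/\ p != [::], path (step f d) x p, last x p = x &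
    forall w s, w \in ws -> pseudo_orbit f d s -> (forall i, chain_class f d x (s i)) ->
      (forall i : 'I_l, w i = q (s i)) ->
      exists2 a, (a + l <= size p)%N &
        forall i, (i < l)%N -> q (nth x (x :: p) (a + i)) = q (s i)].
Proof.
move=> xx; elim: ws => [|w ws [p [p0 dp px pws]]].
  by have /chain_toP[p [p0 dp px]] := xx; exists p; split.
have [[s [ds sx ws_]]|nws] := pselect (exists s, [/\ pseudo_orbit f d s,
    forall i, chain_class f d x (s i) & forall i : 'I_l, w i = q (s i)]); last first.
  exists p; split => // w' s; rewrite inE => /orP[/eqP ->|]; last exact: pws.
  by move=> ds sx ws_; exfalso; apply: nws; exists s.
have [/chain_toP[p1 [p10 dp1 p1s]] _] := sx 0%N.
have [_ /chain_toP[p2 [p20 dp2 p2s]]] := sx l.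
pose m := mkseq (fun i => s i.+1) l.
have dm : path (step f d) (s 0%N) m.
  apply/(pathP (s 0%N)) => i; rewrite size_mkseq => il.
  by case: i il => [|i] il; rewrite /= /m !nth_mkseq ?ds// ltnW.
have ml : last (s 0%N) m = s l.
  rewrite /m; case: l {w ws pws ws_ p2s dp2 m dm} => // l.
  by rewrite (last_nth (s 0%N)) size_mkseq /= nth_mkseq.
exists (p1 ++ m ++ p2 ++ p); split.
- by case: p1 p10 {dp1 p1s}.
- by rewrite !cat_path dp1 p1s dm ml dp2 p2s.
- by rewrite !last_cat p1s ml p2s.
move=> w' s'; rewrite inE => /orP[/eqP -> _ _ ws'|w'ws ds' sx' ws'].
  exists (size p1); first by rewrite !size_cat size_mkseq; lia.
  move=> i il; rewrite nth_cons_cat p1s.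
  rewrite -(ws' (Ordinal il)) ws_ /=; congr q.
  case: i il => //= i il.
  by rewrite nth_cat size_mkseq (ltnW il) nth_mkseq// ltnW.
have [a ap ai] := pws _ _ w'ws ds' sx' ws'.
exists (size (p1 ++ m ++ p2) + a)%N; first by rewrite !size_cat; rewrite /= in ap *; lia.
move=> i il; rewrite -addnA.
have -> : p1 ++ m ++ p2 ++ p = (p1 ++ m ++ p2) ++ p by rewrite !catA.
by rewrite nth_cons_cat !last_cat p1s ml p2s ai.
Qed.

Lemma loop_pseudo_orbit x p : p != [::] -> path (step f d) x p -> last x p = x ->
  pseudo_orbit f d (fun i => nth x (x :: p) (i %% size p)).
Proof.
move=> p0 dp px i; have sp : (0 < size p)%N by rewrite lt0n size_eq0.
have isp : (i %% size p < size p)%N by rewrite ltn_pmod.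
have := pathP x dp _ isp.
suff -> : nth x (x :: p) (i.+1 %% size p) = nth x p (i %% size p) by [].
have -> : (i.+1 %% size p = (i %% size p).+1 %% size p)%N by rewrite -addn1 -modnDml addn1.
have [i1|] := ltnP (i %% size p).+1 (size p); first by rewrite modn_small.
move=> i1; have i1p : (i %% size p).+1 = size p by apply/eqP; rewrite eqn_leq i1 isp.
by rewrite i1p modnn /= -[LHS]px -nth_last -[in LHS]i1p.
Qed.

Hypothesis d0 : 0 < d.
Hypothesis Esym : forall x y, E x y -> E y x.
Hypothesis Etrans : forall x y z, E x y -> E y z -> E x z.
Hypothesis Eunif : exists2 e, 0 < e & forall x y, mdist x y < e -> E x y.
Hypothesis cf : continuous f.
Hypothesis cX : compact [set: X].

(** By [Eunif] the classes of the equivalence [E] are open, hence also closed. *)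
Lemma closed_traces_upto s l :
  closed [set t | forall i, (i < l)%N -> E (s i) (iter i f t)].
Proof.
move=> t tF i il; have [e e0 eE] := Eunif.
have [r r0 tr] := continuous_mdist (iter i f) t e (continuous_iter f i cf) e0.
have [|u [/= uF tu]] := tF [set u | mdist t u < r]; first by apply/nbhs_mdist; exists r.
by apply: Etrans (uF i il) _; apply/Esym/eE/tr.
Qed.

Lemma closed_traces s : closed (traces s).
Proof.
rewrite (_ : traces s =
    \bigcap_l [set t | forall i, (i < l)%N -> E (s i) (iter i f t)]).
  by apply: closed_bigI => l _; exact: closed_traces_upto.
apply/seteqP; split=> t tt; first by move=> l _ i _; exact: tt.
by move=> i; exact: (tt i.+1 Logic.I i (ltnSn i)).
Qed.

(** The orbit segment between two visits near [y] becomes a loop at [y] once its ends are moved.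
    Multiples of [k] keep the phase of a pseudo-orbit of period [k]. *)
Lemma orbit_cluster_recurrent x k : (0 < k)%N ->
  exists2 y, chain_recurrent f y &
    forall e N, 0 < e -> exists2 n, (N <= n)%N & mdist y (iter (k * n) f x) < e.
Proof.
move=> k0; have [y yu] := compact_seq_cluster (fun n => iter (k * n) f x) cX.
exists y => // r r0.
have r30 : 0 < r / 3 by lra.
have [e e0 ye] := continuous_mdist f y (r / 3) cf r30.
have [n _ yn] := yu e 0%N e0.
have [m nm ym] := yu (r / 3) n.+1 r30.
apply: (chain_to_perturb _ _ (iter (k * n) f x) _ (iter (k * m) f x)).
- have -> : (k * m = (k * m - k * n).-1.+1 + k * n)%N by nia.
  rewrite iterD; elim: (_.-1) => [|j IHj]; first exact/chain_to_step/ltW.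
  by apply: chain_to_trans IHj _; exact/chain_to_step/ltW.
- by rewrite metric_sym; exact/ltW/ye.
- by rewrite metric_sym ltW.
Qed.

Hypothesis X0 : @covering_dim_zero R X.
Hypothesis Etrace : forall s, pseudo_orbit f d s -> exists z, traces s z.

(* Shadow the periodic pseudo-orbit that runs through all words of length l by z; a
   cluster point of the iterates of z along multiples of the period shadows it too,
   and is moreover chain recurrent. *)
Lemma class_traced_upto l x : chain_recurrent f x ->
  exists2 y, chain_recurrent f y & forall s, pseudo_orbit f d s ->
    (forall i, chain_class f d x (s i)) ->
    exists2 t, chain_equiv f y t & forall i, (i < l)%N -> E (s i) (iter i f t).
Proof.
move=> cx; have [e e0 eE] := Eunif.
(* Equal letters under [q] force [E], and there are finitely many words of length [l]. *)
have [N [q [qe _]]] := finite_cells e cX X0 e0.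
have [p [p0 dp px pw]] := loop_through_words _ q l x (enum {ffun 'I_l -> 'I_N}) (cx d d0).
have sp : (0 < size p)%N by rewrite lt0n size_eq0.
have [z zp] := Etrace _ (loop_pseudo_orbit x p p0 dp px).
have [y cy yz] := orbit_cluster_recurrent z _ sp.
have yp : traces (fun i => nth x (x :: p) (i %% size p)) y.
  apply: closed_traces => A /nbhs_mdist[r r0 rA].
  have [n _ yn] := yz r 0%N r0; exists (iter (size p * n) f z).
  split; last exact: rA.
  by move=> i; have := zp (i + size p * n)%N; rewrite iterD addnC mulnC modnMDl.
exists y => // s ds sx.
have [] := pw [ffun i : 'I_l => q (s i)] s _ ds sx; first by rewrite mem_enum.
  by move=> i; rewrite ffunE.
(* The word of [s] is read from position [a] of the loop; [a + l <= size p] prevents wrapping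
   around. *)
move=> a ap ai; exists (iter a f y).
  by apply: chain_equiv_iter => //; exact: chain_equiv_refl.
move=> i il; rewrite -iterD addnC.
apply: Etrans (yp _); apply: eE; apply: qe.
by rewrite modn_small ?ai//; lia.
Qed.

(** Let [y] be a limit of the points found for growing [l]. For fixed [s], the points of its
    component tracing [s] up to [l] form nested closed sets, each nonempty because saturations of
    closed sets are closed. *)
Lemma class_traced_exists x : chain_recurrent f x ->
  exists2 y, chain_recurrent f y & class_traced x y.
Proof.
move=> cx.
have /choice[u uP] l : exists y, chain_recurrent f y /\ forall s, pseudo_orbit f d s ->
    (forall i, chain_class f d x (s i)) ->
    exists2 t, chain_equiv f y t & forall i, (i < l)%N -> E (s i) (iter i f t).
  by have [y] := class_traced_upto l x cx; exists y.
have [y yu] := compact_seq_cluster u cX.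
exists y.
  apply: closed_chain_recurrent => // A /nbhs_mdist[r r0 rA].
  have [n _ yn] := yu r 0%N r0; exists (u n).
  by split; [case: (uP n)|exact: rA].
move=> s ds sx.
pose F l := chain_component f y `&` [set t | forall i, (i < l)%N -> E (s i) (iter i f t)].
have [| | |t tF] := compact_seq_cluster_mem F cX.
- move=> l; apply: closedI; last exact: closed_traces_upto.
  move=> t ty; apply: chain_equiv_closed => // e e0.
  have [|v [yv tv]] := ty [set v | mdist t v < e]; first by apply/nbhs_mdist; exists e.
  by exists y, v; rewrite mdistxx.
- move=> n m nm t [yt tm]; split => // i il; apply: tm; exact: leq_trans nm.
- move=> l; suff [t yt tl] : [set y | exists2 t, chain_equiv f y t &
      [set t | forall i, (i < l)%N -> E (s i) (iter i f t)] t] y by exists t.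
  apply: closed_chain_saturation => //; first exact: closed_traces_upto.
  move=> A /nbhs_mdist[r r0 rA]; have [n ln yn] := yu r l r0.
  exists (u n); split; last exact: rA.
  have [_ /(_ s ds sx)[t ut tn]] := uP n; exists t => // i il.
  by apply: tn; exact: leq_trans ln.
exists t; first by have [] := tF 0%N.
by move=> i; have [_] := tF i.+1; exact.
Qed.

Lemma closed_class_traced x : closed (class_traced x).
Proof.
move=> y yF s ds sx; apply: (closed_chain_saturation f cf cX _ (closed_traces s)) => A Ay.
by have [v [vF vA]] := yF A Ay; exists v; split => //; exact: vF.
Qed.

End Tracing.

(* Maximize the number of q-values lying below a point. *)
Lemma finite_preorder_maximal (T : Type) (A : set T) (N : nat) (q : T -> 'I_N)
    (W : T -> T -> Prop) :
  (forall x y z, W x y -> W y z -> W x z) ->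
  (forall x y, A x -> A y -> q x = q y -> W x y) ->
  A !=set0 -> exists2 b, A b & forall x, A x -> W b x -> W x b.
Proof.
move=> Wtrans Wq [a Aa].
pose D x := [set i | `[< exists z, [/\ A z, q z = i & W z x] >]]%SET.
pose P k := `[< exists2 x, A x & #|D x| = k >].
have exP : exists k, P k by exists #|D a|; apply/asboolP; exists a.
have ubP k : P k -> (k <= N)%N.
  by move=> /asboolP[x _ <-]; rewrite -[N in (_ <= N)%N]card_ord max_card.
case: (ex_maxnP exP ubP) => k /asboolP[b Ab Dbk] maxk.
exists b => // x Ax bx.
have Dbx : D b \subset D x.
  apply/fintype.subsetP => i; rewrite !inE => -[z [Az zi zb]].
  by exists z; split => //; exact: Wtrans zb bx.
have /eqP Dxb : D b == D x.
  by rewrite eqEcard Dbx Dbk maxk//; apply/asboolP; exists x.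
have : q x \in D b by rewrite Dxb inE; apply/asboolP; exists x; split => //; exact: Wq.
by rewrite inE => /asboolP[z [Az zx zb]]; apply: (Wtrans _ z) => //; exact: Wq.
Qed.

(** * Selection of a point traced by itself at every level *)

Section Selection.
Context {R : realType} {X : metricType R} (f : X -> X).
Context (E : nat -> X -> X -> Prop) (d : nat -> R).
Hypothesis cX : compact [set: X].
Hypothesis X0 : @covering_dim_zero R X.
Hypothesis cf : continuous f.
Hypothesis Esym : forall n x y, E n x y -> E n y x.
Hypothesis Etrans : forall n x y z, E n x y -> E n y z -> E n x z.
Hypothesis Eunif : forall n, exists2 e, 0 < e & forall x y, mdist x y < e -> E n x y.
Hypothesis Edec : forall m n x y, (n <= m)%N -> E m x y -> E n x y.
Hypothesis d0 : forall n, 0 < d n.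
Hypothesis Etrace : forall n s, pseudo_orbit f (d n) s -> exists z, traces f (E n) s z.

Lemma orbit_in_class x t e : 0 < e -> chain_equiv f x t ->
  pseudo_orbit f e (fun i => iter i f t) /\
  forall i, chain_class f e x (iter i f t).
Proof.
move=> e0 xt; split=> i; first by rewrite /step /= mdistxx ltW.
by apply: chain_equiv_class => //; exact: chain_equiv_iter.
Qed.

(** A tracing orbit in the component of [y] also lies in the [d m]-chain class of [y], so the finer
    tracing applies to it. *)
Lemma class_traced_trans n m x y z : (n <= m)%N ->
  class_traced f (E n) (d n) x y -> class_traced f (E m) (d m) y z ->
  class_traced f (E n) (d n) x z.
Proof.
move=> nm xy yz s ds sx; have [t yt st] := xy s ds sx.
have [dt ty] := orbit_in_class y t (d m) (d0 m) yt.
have [u zu tu] := yz _ dt ty; exists u => // i.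
by apply: Etrans (st i) _; exact: Edec nm (tu i).
Qed.

(** The preorder by inclusion of itinerary sets. Unlike [class_traced], it depends only on
    [d n]-chain classes, finitely many among recurrent points. *)
Definition class_matched n x y := forall s, pseudo_orbit f (d n) s ->
  (forall i, chain_class f (d n) x (s i)) ->
  exists s', [/\ pseudo_orbit f (d n) s', forall i, chain_class f (d n) y (s' i) &
    forall i, E n (s i) (s' i)].

Lemma class_traced_matched n x y : class_traced f (E n) (d n) x y -> class_matched n x y.
Proof.
move=> xy s ds sx; have [t yt st] := xy s ds sx.
have [dt ty] := orbit_in_class y t (d n) (d0 n) yt.
by exists (fun i => iter i f t).
Qed.

Lemma class_matched_traced n x y z : class_matched n x y ->
  class_traced f (E n) (d n) y z -> class_traced f (E n) (d n) x z.
Proof.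
move=> xy yz s ds sx; have [s' [ds' sy ss']] := xy s ds sx.
by have [t zt st] := yz s' ds' sy; exists t => // i; exact: Etrans (ss' i) (st i).
Qed.

(** Recurrent points in one cell of mesh [d n / 3] have the same [d n]-chain class, so the cell
    index [q] is a finite labelling for the preorder. *)
Lemma class_matched_maximal n (A : set X) : A `<=` chain_recurrent f -> A !=set0 ->
  exists2 b, A b & forall x, A x -> class_matched n b x -> class_matched n x b.
Proof.
move=> Acr; have d30 : 0 < d n / 3 by have := d0 n; lra.
have [N [q [qd _]]] := finite_cells (d n / 3) cX X0 d30.
apply: (finite_preorder_maximal X A N q).
  move=> x y z xy yz s ds sx; have [s' [ds' sy ss']] := xy s ds sx.
  have [s2 [ds2 sz ss2]] := yz s' ds' sy; exists s2; split => // i.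
  exact: Etrans (ss' i) (ss2 i).
move=> x y Ax Ay qxy s ds sx; exists s; split => // i.
  apply: (chain_class_close _ _ x) => //; [exact: Acr|exact: Acr|].
  exact/ltW/qd.
by have [e e0 eE] := Eunif n; apply: eE; rewrite mdistxx.
Qed.

(* The last clause allows a further restriction at every level m >= n without
   making the set empty. *)
Definition traceable n (T : set X) := [/\ closed T, T !=set0, T `<=` chain_recurrent f &
  forall m x y, (n <= m)%N -> T x -> chain_recurrent f y ->
    class_traced f (E m) (d m) x y -> T y].

(** If a maximal [b] is traced by [x], it is matched by [x]; maximality matches [x] back to [b], and
    composing traces [x] by itself. *)
Lemma traceable_refine n T : traceable n T -> exists T', [/\ T' `<=` T,
  traceable n.+1 T' & forall x, T' x -> class_traced f (E n) (d n) x x].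
Proof.
move=> [cT T0 Tcr Tup].
have [b Tb bmax] := class_matched_maximal n T Tcr T0.
exists (T `&` class_traced f (E n) (d n) b); split; first by move=> x [].
- split.
  + apply: closedI => //.
    exact: closed_class_traced (Esym n) (Etrans n) (Eunif n) cf cX b.
  + have [y cy byy] := class_traced_exists f (E n) (d n) (d0 n) (Esym n) (Etrans n)
      (Eunif n) cf cX X0 (Etrace n) b (Tcr _ Tb).
    by exists y; split => //; exact: (Tup n b).
  + by move=> x [/Tcr].
  + move=> m x y nm [Tx bx] cy xy; split; first exact: (Tup m x y (ltnW nm)).
    exact: class_traced_trans (ltnW nm) bx xy.
- move=> x [Tx bx]; apply: (class_matched_traced n x b x _ bx).
  by apply: bmax => //; exact: class_traced_matched bx.
Qed.

Lemma class_self_traced_exists T : traceable 0 T ->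
  exists2 x, T x & forall n, class_traced f (E n) (d n) x x.
Proof.
move=> T0.
have /choice[g gP] (nT : nat * set X) : exists T', traceable nT.1 nT.2 ->
    [/\ T' `<=` nT.2, traceable nT.1.+1 T' &
        forall x, T' x -> class_traced f (E nT.1) (d nT.1) x x].
  have [nT2|] := pselect (traceable nT.1 nT.2); last by exists set0.
  by have [T' T'P] := traceable_refine _ _ nT2; exists T'.
pose U := fix U n := if n is m.+1 then g (m, U m) else T.
have tU n : traceable n (U n) by elim: n => // n IHn; have [] := gP (n, U n) IHn.
have US n : U n.+1 `<=` U n by have [] := gP (n, U n) (tU n).
have [| | |x xU] := compact_seq_cluster_mem U cX.
- by move=> n; have [] := tU n.
- move=> n m; elim: m => [|m IHm]; first by rewrite leqn0 => /eqP ->.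
  rewrite leq_eqVlt => /orP[/eqP ->//|nm].
  exact: subset_trans (US m) (IHm nm).
- by move=> n; have [] := tU n.
exists x; first exact: (xU 0%N).
by move=> n; have [_ _] := gP (n, U n) (tU n); apply; exact: (xU n.+1).
Qed.

(** For the last clause of [traceable], the orbit of [t] is itself traced by some [u] in the
    component of [y], and [u] stays in the level 0 cell of [x0]. *)
Lemma traceable_near x0 : chain_recurrent f x0 ->
  traceable 0 (chain_recurrent f `&` [set x | exists2 t, chain_equiv f x t & E 0%N x0 t]).
Proof.
move=> cx0; split.
- apply: closedI; first exact: closed_chain_recurrent.
  apply: closed_chain_saturation => //.
  have := closed_traces_upto f (E 0%N) (Esym 0%N) (Etrans 0%N) (Eunif 0%N) cf (fun=> x0) 1.
  congr (closed _); apply/seteqP; split=> t /= x0t; first exact: (x0t 0%N).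
  by case.
- exists x0; split => //; exists x0; first exact: chain_equiv_refl.
  by have [e e0 eE] := Eunif 0%N; apply: eE; rewrite mdistxx.
- by move=> x [].
- move=> m x y _ [cx [t xt x0t]] cy xy; split => //.
  have [dt tx] := orbit_in_class x t (d m) (d0 m) xt.
  have [u yu tu] := xy _ dt tx; exists u => //.
  by apply: Etrans x0t _; exact: Edec (tu 0%N).
Qed.

End Selection.

(* Density of C_sh(f) in C(f) = CR(f)/<->_f (quotient topology), unfolded:
   every nonempty open set of the quotient, i.e. every nonempty saturated set
   of the form V `&` CR(f) with V open in X, contains a chain component on
   which f has the shadowing property. *)
Theorem theorem6p1 (R : realType) (X : metricType R) (f : X -> X) :
  compact [set: X] -> continuous f -> shadowing f -> @covering_dim_zero R X ->
  forall V : set X, open V ->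
    (forall x y, chain_recurrent f x -> V x -> chain_equiv f x y -> V y) ->
    (exists x, chain_recurrent f x /\ V x) ->
    exists x, [/\ chain_recurrent f x, V x &
                 shadowing_on f (chain_component f x)].
Proof.
move=> cX cf sh X0 V oV satV [x0 [cx0 Vx0]].
have /nbhs_mdist[r r0 rV] : nbhs x0 V by exact: open_nbhs_nbhs.
(* [P n] means lying in a common cell of mesh [r / n.+1%:R]; at level 0 this keeps the cell of [x0]
   inside [V]. *)
have /choice[P PP] n : exists P : X -> X -> Prop,
    [/\ forall x y, P x y -> P y x, forall x y z, P x y -> P y z -> P x z,
        exists2 e, 0 < e & forall x y, mdist x y < e -> P x y &
        forall x y, P x y -> mdist x y < r / n.+1%:R].
  have [|N [q [qd lq]]] := finite_cells (r / n.+1%:R) cX X0; first by rewrite divr_gt0.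
  exists (fun x y => q x = q y); split => //.
    by move=> x y z -> ->.
  exact: (locally_constant_uniform _ q).
pose E n x y := forall j, (j <= n)%N -> P j x y.
have Esym n x y : E n x y -> E n y x.
  by move=> xy j jn; have [Ps _ _ _] := PP j; exact/Ps/xy.
have Etrans n x y z : E n x y -> E n y z -> E n x z.
  by move=> xy yz j jn; have [_ Pt _ _] := PP j; exact: Pt (xy j jn) (yz j jn).
have Eunif n : exists2 e, 0 < e & forall x y, mdist x y < e -> E n x y.
  elim: n => [|n [e e0 eE]].
    have [_ _ [e e0 eP] _] := PP 0%N; exists e => // x y xy j.
    by rewrite leqn0 => /eqP ->; exact: eP.
  have [_ _ [e' e'0 eP] _] := PP n.+1; exists (Num.min e e').
    by rewrite lt_min e0.
  move=> x y; rewrite lt_min => /andP[xy xy'] j.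
  by rewrite leq_eqVlt => /orP[/eqP ->|]; [exact: eP|exact: eE].
have Edec m n x y : (n <= m)%N -> E m x y -> E n x y.
  by move=> nm xy j jn; apply: xy; exact: leq_trans nm.
have /choice[d dP] n : exists d, 0 < d /\
    forall s, pseudo_orbit f d s -> exists z, traces f (E n) s z.
  have [e e0 eE] := Eunif n.
  (* Shadowing gives a weak inequality, while [eE] needs a strict one. *)
  have [|d d0 dsh] := sh (e / 2); first by lra.
  exists d; split => // s ds; have [//|//|z [_ zs]] := dsh s.
  exists z => i; apply/Esym/eE; rewrite (le_lt_trans (zs i))//; lra.
have d0 n : 0 < d n by have [] := dP n.
have Etrace n := (dP n).2.
have [x [cx [t xt x0t]] xx] := class_self_traced_exists f E d cX X0 cf Esym Etrans
  Eunif Edec d0 Etrace _ (traceable_near f E d cX cf Esym Etrans Eunif Edec d0 x0 cx0).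
exists x; split => //.
  have Vt : V t.
    apply: rV; have [_ _ _] := PP 0%N; rewrite divr1; apply; exact: x0t.
  have [_ ct _] := xt.
  by apply: (satV t) => //; exact: chain_equiv_sym.
(* [n.+1] exceeds [r / e], so the cells of level [n] have mesh below [e]. *)
move=> e e0; pose n := Num.truncn (r / e).
exists (d n) => // s sx ds.
have [|t' xt' st'] := xx n s ds.
  by move=> i; apply: chain_equiv_class => //; exact: sx.
exists t'; split => // i; have [_ _ _ Pn] := PP n.
rewrite metric_sym ltW// (lt_le_trans (Pn _ _ (st' i n (leqnn n))))//.
rewrite ler_pdivrMr// mulrC -ler_pdivrMr// ltW//.
by rewrite /n; apply: truncnS_gt.
Qed.
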